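(* The map $F:\hat{\mathcal X}\to\hat{\mathcal Y}$, which sends the equivalence class of $(W,g)\in\mathcal X$ to the equivalence class of the solution $u\in\mathcal Y$ of the initial value problem $$\partial_tu(t,x)=f(u(t,x),t)+\int_0^1W(x,y)D(u(t,x),u(t,y))\,dy,\qquad u(0,x)=g(x),$$ is continuous with respect to the distances $d_{\hat{\mathcal X}}$ and $d_{\hat{\mathcal Y}}$.
   Context: Standing assumptions on $f$ and $D$: $f:\mathbb R^2\to\mathbb R$ satisfies $|f(u,t)|\le1$ and $|f(u,t)-f(v,t)|\le L_f|u-v|$ for all $u,v,t\in\mathbb R$, and $f$ is continuous in $t$ for each fixed $u$; $D:\mathbb R^2\to\mathbb R$ satisfies $|D(u,v)|\le1$ and $|D(u,v)-D(u',v')|\le L_D(|u-u'|+|v-v'|)$, and $D\in H^s_{\mathrm{loc}}(\mathbb R^2)$ for some $s>1$ (Sobolev space of functions square integrable together with their generalized derivatives up to order $s$ on compact subsets). $T>0$ is fixed. $\mathcal S$ is the space of measurable functions $[0,1]^2\to[0,1]$, with the distance induced by $$\|W\|_{\infty\to1}=\sup_{-1\le a,b\le1}\int_{[0,1]^2}a(x)b(y)W(x,y)\,dx\,dy$$ (supremum over measurable $a,b:[0,1]\to[-1,1]$). $\mathcal B=L^2([0,1])$ with its norm. $\mathcal X=\mathcal S\times\mathcal B$ with the product topology, and $\mathcal Y=C([0,T],\mathcal B)$ with norm $\|u\|_{C(0,T;L^2([0,1]))}=\sup_{t\in[0,T]}\|u(t,\cdot)\|_{L^2([0,1])}$. $\mathcal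 P$ is the set of measure preserving bijections of $[0,1]$. For $\sigma\in\mathcal P$: $W_\sigma(x,y)=W(\sigma(x),\sigma(y))$, $g_\sigma(x)=g(\sigma(x))$, $u_\sigma(t,x)=u(t,\sigma(x))$. Equivalence relations: $(W,g)\sim(W',g')$ if for some $\sigma\in\mathcal P$ both $W'=W_\sigma$ and $g'=g_\sigma$; $u\sim u'$ if $u'=u_\sigma$ for some $\sigma\in\mathcal P$. $\hat{\mathcal X}=\mathcal X/\!\sim$ and $\hat{\mathcal Y}=\mathcal Y/\!\sim$, with distances $$d_{\hat{\mathcal X}}\big(\widehat{(U,g)},\widehat{(V,h)}\big)=\inf_{\sigma\in\mathcal P}\{\|U_\sigma-V\|_{\infty\to1}+\|g_\sigma-h\|_{L^2([0,1])}\},\qquad d_{\hat{\mathcal Y}}(\hat u,\hat v)=\inf_{\sigma\in\mathcal P}\|u_\sigma-v\|_{C(0,T;L^2([0,1]))},$$ for arbitrary representatives. For each $(W,g)\in\mathcal X$ the initial value problem has a unique solution $u=F(W,g)\in\mathcal Y$, and $F(W_\sigma,g_\sigma)=u_\sigma$ for all $\sigma\in\mathcal P$, so that $F$ is viewed as a map $\hat{\mathcal X}\to\hat{\mathcal Y}$. *)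

(* Defs.v *)
From HB Require Import structures.
From mathcomp Require Import all_boot all_order all_algebra.
From mathcomp Require Import generic_quotient.
From mathcomp Require Import all_classical all_reals all_analysis.
From mathcomp Require Import measurable_realfun.

Set Implicit Arguments.
Unset Strict Implicit.
Unset Printing Implicit Defensive.
Import Order.TTheory GRing.Theory Num.Theory.
Import numFieldNormedType.Exports.

Local Open Scope classical_set_scope.
Local Open Scope ring_scope.
Local Open Scope quotient_scope.

Definition unit_interval (R : realType) : Type := {x : R | 0 <= x <= 1}.

HB.instance Definition _ (R : realType) := Choice.on (unit_interval R).

Lemma unit_interval0 (R : realType) : 0 <= (0 : R) <= 1.
Proof. by rewrite lexx ler01. Qed.

HB.instance Definition _ (R : realType) :=
  isPointed.Build (unit_interval R) (exist _ 0 (unit_interval0 R)).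

Section unit_interval_measurable.
Context (R : realType).

Definition unit_interval_val (x : unit_interval R) : R := val x.

Definition unit_interval_measurable : set (set (unit_interval R)) :=
  preimage_set_system setT unit_interval_val
    (@measurable _ (measurableTypeR R)).

Let sigma_algebra_unit_interval : sigma_algebra setT unit_interval_measurable.
Proof.
apply: sigma_algebra_preimage.
exact: (sigma_algebra_measurable (measurableTypeR R)).
Qed.

Let measurable0 : unit_interval_measurable set0.
Proof. by case: sigma_algebra_unit_interval. Qed.

Let measurableC A :
  unit_interval_measurable A -> unit_interval_measurable (~` A).
Proof.
by case: sigma_algebra_unit_interval => _ + _ => /[apply]; rewrite setTD.
Qed.

Let measurable_bigcup (F : (set (unit_interval R))^nat) :
  (forall i, unit_interval_measurable (F i)) ->
  unit_interval_measurable (\bigcup_i (F i)).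
Proof. by case: sigma_algebra_unit_interval => _ _ /(_ F). Qed.

HB.instance Definition _ :=
  isMeasurable.Build (sigma_display (@measurable _ R)) (unit_interval R)
    measurable0 measurableC measurable_bigcup.

Lemma unit_interval_val_inj : injective unit_interval_val.
Proof. exact: val_inj. Qed.

Lemma measurable_unit_interval_image (A : set (unit_interval R)) :
  measurable A -> measurable (unit_interval_val @` A).
Proof.
move=> [B mB <-]; rewrite setTI.
rewrite (_ : _ @` _ = B `&` `[0, 1]%classic).
  by apply: measurableI => //; exact: measurable_itv.
apply/seteqP; split => [_ [x Bx <-]|x [Bx x01]].
  by split => //=; rewrite in_itv/=; exact: (valP x).
by exists (exist _ x x01).
Qed.

Local Notation leb := (@lebesgue_measure R).

Definition unit_interval_lebesgue (A : set (unit_interval R)) : \bar R :=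
  leb (unit_interval_val @` A).

Let mu0 : unit_interval_lebesgue set0 = 0%E.
Proof. by rewrite /unit_interval_lebesgue image_set0 measure0. Qed.

Let mu_ge0 A : (0 <= unit_interval_lebesgue A)%E.
Proof. exact: measure_ge0. Qed.

Let mu_sigma_additive : semi_sigma_additive unit_interval_lebesgue.
Proof.
move=> F mF tF mUF; rewrite /unit_interval_lebesgue image_bigcup.
apply: measure_semi_sigma_additive.
- by move=> i; exact: measurable_unit_interval_image.
- apply/trivIsetP => i j _ _ ij.
  apply/seteqP; split => // _ [[x Fix <-] [y Fjy /unit_interval_val_inj yx]].
  have := (trivIsetP.1 tF) i j I I ij.
  by move=> /seteqP[+ _] => /(_ x); apply; split => //; rewrite -yx.
- by rewrite -image_bigcup; exact: measurable_unit_interval_image.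
Qed.

HB.instance Definition _ := isMeasure.Build _ _ _ unit_interval_lebesgue
  mu0 mu_ge0 mu_sigma_additive.

Let mu_setT : unit_interval_lebesgue setT = 1%E.
Proof.
rewrite /unit_interval_lebesgue (_ : _ @` _ = `[0, 1]%classic).
  by rewrite lebesgue_measure_itv/= lte_fin ltr01 oppr0 adde0.
apply/seteqP; split => [_ [x _ <-]|x x01] /=.
  by rewrite in_itv/=; exact: (valP x).
by exists (exist _ x x01).
Qed.

HB.instance Definition _ :=
  Measure_isProbability.Build _ _ _ unit_interval_lebesgue mu_setT.

End unit_interval_measurable.

Section measure_preserving.
Context d (I : measurableType d) (R : realType) (mu : probability I R).
Local Open Scope ereal_scope.

(* Measurability of the inverse, expressed on images, is part of the usual
   notion of an invertible measure-preserving transformation; on [0, 1] it is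
   automatic for a Borel bijection (Lusin-Souslin). *)
Definition measure_preserving_bijection : set (I -> I) :=
  [set s | [/\ bijective s, measurable_fun setT s,
    forall A, measurable A -> measurable (s @` A) &
    forall A, measurable A -> mu (s @^-1` A) = mu A]].

Local Notation P := measure_preserving_bijection.

Lemma mpb_id : P id.
Proof.
split=> //; first by exists id.
by move=> A mA; rewrite image_id.
Qed.

Lemma mpb_comp s t : P s -> P t -> P (s \o t).
Proof.
move=> [bs ms is_ ps] [bt mt it pt]; split.
- exact: bij_comp.
- exact: measurableT_comp.
- by move=> A mA; rewrite -image_comp; apply: is_; exact: it.
- move=> A mA; rewrite comp_preimage pt ?ps//.
  by rewrite -[X in measurable X]setTI; exact: ms.
Qed.

Lemma mpb_inv s : P s -> exists t, [/\ P t, cancel s t & cancel t s].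
Proof.
move=> [[t st ts] ms is_ ps]; exists t; split => //.
have imt A : t @` A = s @^-1` A.
  apply/seteqP; split => [_ [x Ax <-]|x Ax] /=; first by rewrite ts.
  by exists (s x).
have pret A : t @^-1` A = s @` A.
  apply/seteqP; split => [x Ax|_ [x Ax <-]] /=; last by rewrite st.
  by exists (t x).
split; first by exists s.
- by move=> _ A mA; rewrite setTI pret; exact: is_.
- by move=> A mA; rewrite imt -[X in measurable X]setTI; exact: ms.
- move=> A mA; rewrite pret -(ps (s @` A)); last exact: is_.
  congr (mu _).
  apply/seteqP; split => x /=; last by exists x.
  by move=> [y Ay /(can_inj st) <-].
Qed.

Lemma mpb_prod s (A : set (I * I)) : P s -> measurable A ->
  (mu \x mu) ((fun z => (s z.1, s z.2)) @^-1` A) = (mu \x mu) A.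
Proof.
move=> [_ ms _ ps] mA; rewrite /product_measure1/=.
pose F (x : I) := mu (xsection A x).
have mF : measurable_fun setT F by exact: measurable_fun_xsection.
transitivity (\int[mu]_x (F \o s) x).
  apply: eq_integral => x _ /=.
  rewrite /F -[RHS]ps; last exact: measurable_xsection.
  by congr (mu _); apply/seteqP; split => y; rewrite /xsection/= !inE.
rewrite -[setT in LHS](preimage_setT s).
rewrite -(ge0_integral_pushforward ms mu measurableT mF)//.
by apply: eq_measure_integral => B mB _; exact: ps.
Qed.

Lemma mpb_ae s (Q : I -> Prop) : P s ->
  {ae mu, forall x, Q x} -> {ae mu, forall x, Q (s x)}.
Proof.
move=> Ps [N [mN N0 QN]]; case: (Ps) => _ ms _ ps.
exists (s @^-1` N); split; last by move=> x Qx; exact: QN.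
- by rewrite -[X in measurable X]setTI; exact: ms.
- by rewrite ps.
Qed.

Lemma mpb_ae2 s (Q : I * I -> Prop) : P s ->
  {ae (mu \x mu), forall z, Q z} ->
  {ae (mu \x mu), forall z, Q (s z.1, s z.2)}.
Proof.
move=> Ps [N [mN N0 QN]]; case: (Ps) => _ ms _ ps.
exists ((fun z => (s z.1, s z.2)) @^-1` N); split.
- rewrite -[X in measurable X]setTI.
  have mss : measurable_fun setT (fun z : I * I => (s z.1, s z.2)).
    apply/measurable_fun_pairP; split.
      exact: (measurableT_comp ms measurable_fst).
    exact: (measurableT_comp ms measurable_snd).
  exact: mss.
- by rewrite mpb_prod.
- by move=> x Qx; exact: QN.
Qed.

End measure_preserving.

Section spaces.
Context d (I : measurableType d) (R : realType) (mu : probability I R).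
Local Open Scope ereal_scope.

Local Notation L2 := (LfunType mu (lee1n 2)).
Local Notation P := (measure_preserving_bijection mu).

Definition L2dist (g h : I -> R) : \bar R :=
  'N[mu]_2%:E [ (fun x => (g x - h x)%:E) ].

Definition norm_infty1 (W : I * I -> R) : \bar R :=
  ereal_sup [set r | exists a b : I -> R,
    [/\ measurable_fun setT a, measurable_fun setT b,
        forall x, (-1 <= a x <= 1)%R, forall y, (-1 <= b y <= 1)%R &
        r = \int[mu \x mu]_z (a z.1 * b z.2 * W z)%:E]].

Record unit_kernel := UnitKernel {
  unit_kernel_fun :> {mfun (I * I)%type >-> R};
  unit_kernel_bound : forall z, (0 <= unit_kernel_fun z <= 1)%R }.

HB.instance Definition _ := gen_eqMixin unit_kernel.
HB.instance Definition _ := gen_choiceMixin unit_kernel.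

(* Functions equal almost everywhere are not identified here but in the
   quotients below. *)
Definition ivp_data : Type := (unit_kernel * L2)%type.

HB.instance Definition _ := Choice.on ivp_data.

Record L2path (T : R) := L2Path {
  L2path_fun :> R -> L2;
  L2path_continuous : forall t0, (0 <= t0 <= T)%R ->
    L2dist (L2path_fun t) (L2path_fun t0) @[t --> within `[0%R, T] (nbhs t0)]
      --> 0 }.

HB.instance Definition _ T := gen_eqMixin (L2path T).
HB.instance Definition _ T := gen_choiceMixin (L2path T).

Definition reindex2 (s : I -> I) (W : I * I -> R) : I * I -> R :=
  fun z => W (s z.1, s z.2).

Definition ivp_data_rel (p q : ivp_data) : bool :=
  `[< exists2 s, P s &
        {ae (mu \x mu), forall z, q.1 z = reindex2 s p.1 z} /\
        {ae mu, forall x, q.2 x = p.2 (s x)} >].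

Definition L2path_rel (T : R) (u v : L2path T) : bool :=
  `[< exists2 s, P s &
        forall t, (0 <= t <= T)%R -> {ae mu, forall x, v t x = u t (s x)} >].

Lemma ivp_data_rel_refl : reflexive ivp_data_rel.
Proof.
move=> p; apply/asboolP; exists id; first exact: mpb_id.
by split; apply: aeW => // -[].
Qed.

Lemma ivp_data_rel_sym : symmetric ivp_data_rel.
Proof.
suff sym p q : ivp_data_rel p q -> ivp_data_rel q p.
  by move=> p q; apply/idP/idP; exact: sym.
move=> /asboolP[s Ps [WE gE]]; apply/asboolP.
have [t [Pt _ ts]] := mpb_inv Ps.
exists t => //; split.
- have := mpb_ae2 Pt WE; apply: filterS => -[x y].
  by rewrite /reindex2/= => ->; rewrite !ts.
- by have := mpb_ae Pt gE; apply: filterS => x /= ->; rewrite ts.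
Qed.

Lemma ivp_data_rel_trans : transitive ivp_data_rel.
Proof.
move=> q p r /asboolP[s Ps [W1 g1]] /asboolP[t Pt [W2 g2]].
apply/asboolP; exists (s \o t); first exact: mpb_comp.
split.
- have := mpb_ae2 Pt W1; apply: filterS2 W2 => -[x y].
  by rewrite /reindex2/= => ->.
- by have := mpb_ae Pt g1; apply: filterS2 g2 => x /= ->.
Qed.

Lemma L2path_rel_refl T : reflexive (@L2path_rel T).
Proof.
move=> u; apply/asboolP; exists id; first exact: mpb_id.
by move=> t _; exact: aeW.
Qed.

Lemma L2path_rel_sym T : symmetric (@L2path_rel T).
Proof.
suff sym u v : @L2path_rel T u v -> L2path_rel v u.
  by move=> p q; apply/idP/idP; exact: sym.
move=> /asboolP[s Ps uv]; apply/asboolP.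
have [t [Pt _ ts]] := mpb_inv Ps.
exists t => // r /uv /(mpb_ae Pt).
by apply: filterS => x /= ->; rewrite ts.
Qed.

Lemma L2path_rel_trans T : transitive (@L2path_rel T).
Proof.
move=> v u w /asboolP[s Ps uv] /asboolP[t Pt vw].
apply/asboolP; exists (s \o t); first exact: mpb_comp.
move=> r rT; have := mpb_ae Pt (uv r rT).
by apply: filterS2 (vw r rT) => x /= ->.
Qed.

Canonical ivp_data_equiv :=
  EquivRel ivp_data_rel ivp_data_rel_refl ivp_data_rel_sym ivp_data_rel_trans.

Canonical L2path_equiv (T : R) := EquivRel (@L2path_rel T)
  (@L2path_rel_refl T) (@L2path_rel_sym T) (@L2path_rel_trans T).

Definition ivp_data_quot : Type := {eq_quot ivp_data_rel}.
HB.instance Definition _ := Choice.on ivp_data_quot.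
HB.instance Definition _ := EqQuotient.on ivp_data_quot.

Definition L2path_quot (T : R) : Type := {eq_quot (@L2path_rel T)}.
HB.instance Definition _ T := Choice.on (L2path_quot T).
HB.instance Definition _ T := EqQuotient.on (L2path_quot T).

Definition ivp_data_dist (x y : ivp_data_quot) : \bar R :=
  let: (U, g) := repr x in let: (V, h) := repr y in
  ereal_inf [set norm_infty1 (fun z => reindex2 s U z - V z)%R +
                 L2dist (g \o s) h | s in P].

Definition L2path_dist (T : R) (x y : L2path_quot T) : \bar R :=
  let u := repr x in let v := repr y in
  ereal_inf [set ereal_sup [set L2dist (u t \o s) (v t) |
                             t in [set t | (0 <= t <= T)%R]] | s in P].

(* The time derivative is the derivative in L^2, one-sided at 0 and T. *)
Definition solves_ivp (f D : R -> R -> R) (T : R) (p : ivp_data)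
    (u : L2path T) :=
  {ae mu, forall x, u 0%R x = p.2 x} /\
  forall t, (0 <= t <= T)%R ->
    L2dist (fun x => (u r x - u t x) / (r - t))%R
           (fun x => f (u t x) t +
              \int[mu]_y (p.1 (x, y) * D (u t x) (u t y)))%R
      @[r --> within `[0%R, T] t^'] --> 0.

Definition is_solution_map (f D : R -> R -> R) (T : R)
    (F : ivp_data_quot -> L2path_quot T) :=
  forall p : ivp_data, exists2 u : L2path T,
    solves_ivp f D p u & F (\pi p) = \pi u.

End spaces.

Definition continuous_dist (R : realType) (X Y : Type)
    (dX : X -> X -> \bar R) (dY : Y -> Y -> \bar R) (F : X -> Y) :=
  forall x (e : R), 0 < e -> exists2 r : R, 0 < r &
    forall y, (dX x y < r%:E)%E -> (dY (F x) (F y) < e%:E)%E.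

Section sobolev.
Context (R : realType).
Local Notation leb := (@lebesgue_measure R).
Local Notation leb2 := (leb \x leb)%E.

Definition partial (b : bool) (h : R * R -> R) : R * R -> R :=
  'D_(if b then (0, 1) else (1, 0)) h.

Definition smooth (h : R * R -> R) :=
  forall w : seq bool, let h' := foldr partial h w in
    continuous h' /\
    forall z, derivable h' z (1, 0) /\ derivable h' z (0, 1).

Definition test_function (phi : R * R -> R) :=
  smooth phi /\
  exists2 K, compact K & forall z, ~ K z -> phi z = 0.

Definition locally_square_integrable (h : R * R -> R) :=
  measurable_fun setT h /\
  forall K, compact K -> (\int[leb2]_(z in K) (h z ^+ 2)%:E < +oo)%E.

Definition weak_derivative (i j : nat) (h g : R * R -> R) :=
  forall phi, test_function phi ->
    \int[leb2]_z (h z * iter i (partial false) (iter j (partial true) phi) z) =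
    (-1) ^+ (i + j) * \int[leb2]_z (g z * phi z).

(* For s = m + theta with 0 < theta < 1 the derivatives of order m are required
   to have locally finite Sobolev-Slobodeckij (Gagliardo) seminorm of order
   theta; in dimension 2 its kernel is |z - w|^-(2 + 2 theta). *)
Definition Hs_loc (s : R) (h : R * R -> R) :=
  let m := Num.truncn s in let theta := s - m%:R in
  exists G : nat -> nat -> R * R -> R,
  [/\ G 0%N 0%N = h,
      forall i j, (i + j <= m)%N ->
        locally_square_integrable (G i j) /\ weak_derivative i j h (G i j) &
      0 < theta -> forall i j, (i + j = m)%N -> forall K, compact K ->
        (\int[leb2]_(z in K) \int[leb2]_(w in K)
           ((G i j z - G i j w) ^+ 2 /
            ((z.1 - w.1) ^+ 2 + (z.2 - w.2) ^+ 2) `^ (1 + theta))%:E < +oo)%E].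

End sobolev.

(* Main.v *)
Require Import Defs.
From mathcomp Require Import all_boot all_order all_algebra generic_quotient.
From mathcomp Require Import all_classical all_reals all_analysis.
From mathcomp Require Import measurable_realfun.
From mathcomp Require Import lra.
Import Order.TTheory GRing.Theory Num.Theory.
Import numFieldNormedType.Exports.
Local Open Scope classical_set_scope.
Local Open Scope ring_scope.

(** Continuity at a class is a local statement, so the solution u attached to
    the data (U, g) may be fixed while (V, h), with its solution v, varies.
    Composing u with a measure-preserving bijection s that almost realizes the
    infimum in the distance of the data gives the solution for the relabelled
    data, so both curves live on the same space; writing u and U for the
    relabelled objects, the L^2 curve u - v has derivative

      [f(u) - f(v)] + int V(x,y) (D(u(x),u(y)) - D(v(x),v(y))) dy + Z,
      Z(x) = int (U - V)(x,y) D(u(x),u(y)) dy.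

    The first two terms are Lipschitz in u - v (rhs_dist_le), so a Gronwall
    argument bounds u - v by g - h and sup_t |Z(t)|_2 (L2_solution_stability).
    The norm of u - v need not be differentiable where it vanishes; the version
    of Gronwall that is used asks only for a local bound on increments
    (dini_gronwall).

    What is left is that Z is small in L^2 when U - V is small in the weak norm
    infinity -> 1. Since |Z|_2^2 is the double integral of
    Z(x) (U - V)(x,y) D(u(x),u(y)), it suffices to separate x from y in the last
    factor. Let w take k values and approximate u in L^1. Replacing u(x) by w(x)
    costs at most LD |u - w|_1, and

      D(w(x),u(y)) = sum over the values c of w of 1[w(x) = c] D(c,u(y))

    is a sum of k products of a bounded function of x and a bounded function of
    y, so the remaining integral is at most k |U - V| (coupling_sqr_le). The
    number k depends on u(t) and on the precision, and not on s, because w o s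
    has the same values as w and approximates u o s equally well; it can be kept
    the same for nearby times because u is continuous in time, hence by
    compactness finitely many w serve for the whole of [0, T]
    (coupling_uniformly_small).

    Finally the distances between classes are computed on chosen
    representatives, which differ from the solutions above by measure-preserving
    bijections; these are absorbed in the infimum (L2path_dist_le). *)

Set Implicit Arguments.
Unset Strict Implicit.

(** * The L^2 norm on a probability space, and bounded integrands *)

Section L2_norm.
Context d (I : measurableType d) (R : realType) (mu : probability I R).
Local Open Scope ereal_scope.

Local Notation N f := ('N[mu]_2%:E [ (fun x => (f x)%:E) ]).

Let measurable_normr_pow2 (h : I -> R) : measurable_fun setT h ->
  measurable_fun [set: I] (fun x => (`|h x| `^ 2)%:E).
Proof.
move=> mh; apply/measurable_EFinP.
apply: (@measurableT_comp _ _ _ _ _ _ (@powR R ^~ 2%R)) => //.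
exact: measurableT_comp.
Qed.

Lemma L2norm_le (f g : I -> R) : measurable_fun setT f -> measurable_fun setT g ->
  (forall x, `|f x| <= `|g x|)%R -> N f <= N g.
Proof.
move=> mf mg fg; rewrite unlock /Lnorm/=.
apply: gt0_ler_poweR; rewrite ?invr_ge0// ?in_itv/= ?integral_ge0 ?leey//.
apply: ge0_le_integral => //.
- exact: measurable_normr_pow2.
- exact: measurable_normr_pow2.
- by move=> x _; rewrite lee_fin ge0_ler_powR// nnegrE.
Qed.

Lemma L2normD (f g : I -> R) : measurable_fun setT f -> measurable_fun setT g ->
  N (fun x => f x + g x)%R <= N f + N g.
Proof. by move=> mf mg; apply: (minkowski_EFin mu mf mg); rewrite ler1n. Qed.

Lemma L2norm_sqr (f : I -> R) : N f `^ 2 = \int[mu]_x (f x ^+ 2)%:E.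
Proof.
rewrite poweR_Lnorm ?pnatr_eq0//; apply: eq_integral => x _.
by rewrite abse_EFin poweR_EFin powR_mulrn// real_normK ?num_real.
Qed.

Lemma L2norm_le_sqr (f : I -> R) (a : R) : (0 <= a)%R ->
  \int[mu]_x (f x ^+ 2)%:E <= (a ^+ 2)%:E -> N f <= a%:E.
Proof.
move=> a0; rewrite -L2norm_sqr -(powR_mulrn _ a0) -poweR_EFin.
have := Lnorm_ge0 mu 2%:E (fun x => (f x)%:E).
case: ('N[mu]_2%:E[_]) => [r| |] //=.
  by rewrite !lee_fin => r0; rewrite !powR_mulrn// ler_pXn2r// nnegrE.
by rewrite pnatr_eq0.
Qed.

Lemma L2normZ (c : R) (f : I -> R) : measurable_fun setT f ->
  N (fun x => c * f x)%R = `|c|%:E * N f.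
Proof.
move=> mf; rewrite unlock /Lnorm/=.
under eq_integral do rewrite normrM powRM// EFinM.
rewrite ge0_integralZl//.
- rewrite poweRM ?integral_ge0 ?lee_fin ?powR_ge0//.
  by rewrite poweR_EFin -powRrM mulfV ?pnatr_eq0// powRr1.
- exact: measurable_normr_pow2.
Qed.

Lemma L2norm_cst (c : R) : N (fun=> c) = `|c|%:E.
Proof.
have := @L2normZ c (fun=> 1%R) (measurable_cst _).
rewrite (_ : N (fun=> 1%R) = 1); last first.
  by have := Lnorm_cst1 mu 2; rewrite [X in X `^ _](probability_setT mu) poweR1r.
by rewrite mule1 => <-; apply: eq_Lnorm => x; rewrite mulr1.
Qed.

Lemma L1_le_L2 (f : I -> R) : measurable_fun setT f ->
  \int[mu]_x `|f x|%:E <= N f.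
Proof.
move=> mf; have := @hoelder _ _ _ mu f (fun=> 1%R) 2 2 mf (measurable_cst _).
rewrite L2norm_cst normr1 mule1 Lnorm1.
under eq_integral do rewrite /= mulr1.
by apply => //; lra.
Qed.

Lemma L2norm_ae (f g : I -> R) : measurable_fun setT f -> measurable_fun setT g ->
  {ae mu, forall x, f x = g x} -> N f = N g.
Proof.
move=> mf mg fg; rewrite unlock /Lnorm/=; congr (_ `^ _).
apply: ae_eq_integral => //; [exact: measurable_normr_pow2|exact: measurable_normr_pow2|].
by apply: filterS fg => x -> _.
Qed.

(** A measure-preserving bijection pushes mu forward to itself. *)
Lemma integral_mpb (s : I -> I) (f : I -> \bar R) :
  measure_preserving_bijection mu s -> measurable_fun setT f ->
  \int[mu]_x f (s x) = \int[mu]_x f x.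
Proof.
move=> [_ ms _ ps] mf.
have ipos h : measurable_fun setT h -> (forall x, 0 <= h x) ->
    \int[mu]_x h (s x) = \int[mu]_x h x.
  move=> mh h0; rewrite -[setT in LHS](preimage_setT s).
  rewrite -(ge0_integral_pushforward ms mu measurableT mh)//.
  by apply: eq_measure_integral => B mB _; exact: ps.
rewrite integralE [RHS]integralE; congr (_ - _).
- rewrite -(ipos _ (measurable_funepos mf) (funepos_ge0 f)).
  by apply: eq_integral => x _; rewrite unlock.
- rewrite -(ipos _ (measurable_funeneg mf) (funeneg_ge0 f)).
  by apply: eq_integral => x _; rewrite unlock.
Qed.

Lemma L2norm_mpb (s : I -> I) (f : I -> R) :
  measure_preserving_bijection mu s -> measurable_fun setT f ->
  N (f \o s) = N f.
Proof.
move=> Ps mf; rewrite unlock /Lnorm/=; congr (_ `^ _).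
by rewrite (integral_mpb Ps (measurable_normr_pow2 mf)).
Qed.

End L2_norm.

Section bounded_functions.
Context d (X : measurableType d) (R : realType) (P : probability X R).

Lemma bounded_integrable (f : X -> R) (C : R) : measurable_fun setT f ->
  (forall x, `|f x| <= C) -> P.-integrable setT (EFin \o f).
Proof.
move=> mf fC; apply: measurable_bounded_integrable => //.
  by rewrite ltey_eq fin_num_measure.
exists C; split; rewrite ?num_real// => M CM x _ /=.
by rewrite (le_trans (fC x))// ltW.
Qed.

Lemma le_normr_Rintegral_bound (f : X -> R) (C : R) : measurable_fun setT f ->
  (forall x, `|f x| <= C) -> `|\int[P]_x f x| <= C.
Proof.
move=> mf fC; apply: le_trans (le_normr_Rintegral measurableT _) _.
  exact: bounded_integrable fC.
have -> : C = \int[P]_x C.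
  by rewrite Rintegral_cst// [X in fine X](probability_setT P) mulr1.
apply: le_Rintegral => //.
- apply: (@bounded_integrable _ C); first exact: measurableT_comp.
  by move=> x; rewrite normr_id.
- exact: (@bounded_integrable (fun=> C) `|C|).
Qed.

End bounded_functions.

Section bounded_fubini.
Context d (I : measurableType d) (R : realType) (mu : probability I R).

Lemma measurable_Rintegral_snd (K : I * I -> R) (C : R) : measurable_fun setT K ->
  (forall z, `|K z| <= C) -> measurable_fun setT (fun x => \int[mu]_y K (x, y)).
Proof.
move=> mK KC; apply: measurableT_comp => //.
apply: (@measurable_fubini_F _ _ _ _ _ mu mu (EFin \o K)).
exact: bounded_integrable KC.
Qed.

(** The inner integral is real-valued and the outer one extended-real because
    this is the form in which a coupling term is tested against a function. *)
Lemma Rintegral_fubini (a : I -> R) (K : I * I -> R) (A C : R) :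
  measurable_fun setT a -> measurable_fun setT K ->
  (forall x, `|a x| <= A) -> (forall z, `|K z| <= C) ->
  (\int[mu]_x (a x * \int[mu]_y K (x, y))%:E =
   \int[mu \x mu]_z (a z.1 * K z)%:E)%E.
Proof.
move=> ma mK aA KC.
have maK : measurable_fun setT (fun z : I * I => a z.1 * K z).
  by apply: measurable_funM => //; exact: measurableT_comp.
have iaK : (mu \x mu)%E.-integrable setT (EFin \o (fun z : I * I => a z.1 * K z)).
  apply: (@bounded_integrable _ _ _ _ _ (A * C)) => // z.
  by rewrite normrM ler_pM.
rewrite -(integral12_prod_meas1 iaK); apply: eq_integral => x _.
rewrite /fubini_F/= EFinM /Rintegral fineK; last first.
  apply: integrable_fin_num => //.
  apply: (@bounded_integrable _ _ _ mu (fun y => K (x, y)) C) => //.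
  exact: measurable_fun_pair2.
rewrite -integralZl//.
apply: (@bounded_integrable _ _ _ mu (fun y => K (x, y)) C) => //.
exact: measurable_fun_pair2.
Qed.

End bounded_fubini.

(** * The weak kernel norm controls the coupling term *)

Section coupling.
Context d (I : measurableType d) (R : realType) (mu : probability I R).
Context (D : R -> R -> R) (LD : R).
Context (mD : measurable_fun setT (fun z : R * R => D z.1 z.2)).
Context (D_bounded : forall u v, `|D u v| <= 1).
Context (D_lipschitz : forall u v u' v',
    `|D u v - D u' v'| <= LD * (`|u - u'| + `|v - v'|)).

(** The nonlocal term of the equation, for an arbitrary kernel: it is applied
    to graphons and to differences of graphons. *)
Definition coupling (W : I * I -> R) (u : I -> R) (x : I) : R :=
  \int[mu]_y (W (x, y) * D (u x) (u y)).

Lemma measurable_interaction d' (X : measurableType d') (v w : X -> R) :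
  measurable_fun setT v -> measurable_fun setT w ->
  measurable_fun setT (fun x => D (v x) (w x)).
Proof.
move=> mv mw; exact: (measurableT_comp mD (measurable_fun_pair mv mw)).
Qed.

Lemma lipschitz_const_ge0 : 0 <= LD.
Proof.
by have := D_lipschitz 1 0 0 0; rewrite subrr subr0 normr1 normr0 addr0 mulr1;
  apply: le_trans.
Qed.

Lemma measurable_mem_seq (w : I -> R) (r : seq R) : measurable_fun setT w ->
  measurable_fun setT (fun x => (w x \in r)%:R : R).
Proof.
move=> mw; have -> : (fun x => (w x \in r)%:R : R) = \1_(w @^-1` [set` r]).
  apply/funext => x; rewrite indicE; congr (nat_of_bool _)%:R.
  by apply/idP/idP; rewrite inE.
apply: measurable_indic; rewrite -[X in measurable X]setTI; apply: mw => //.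
by apply: countable_measurable => //; exact/finite_set_countable/finite_seq.
Qed.

Lemma integral_test_le_norm_infty1 (N : I * I -> R) (a b : I -> R) :
  measurable_fun setT a -> measurable_fun setT b ->
  (forall x, `|a x| <= 1) -> (forall y, `|b y| <= 1) ->
  (\int[mu \x mu]_z (a z.1 * b z.2 * N z)%:E <= norm_infty1 mu N)%E.
Proof.
move=> ma mb a1 b1; apply: ereal_sup_ubound; exists a, b; split => // x.
- by rewrite -ler_norml.
- by rewrite -ler_norml.
Qed.

(** For a fixed value c the interaction D c (u y) depends on y only, so each
    value of w contributes one product of test functions, which the weak norm
    bounds. Only the first argument of D is discretized: the second already
    separates. Restricting to the points where w lies in r, instead of assuming
    that it always does, is what makes the induction on r go through. *)
Lemma pairing_step_le (N : I * I -> R) (a u w : I -> R) (r : seq R) :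
  measurable_fun setT N -> (forall z, `|N z| <= 1) ->
  measurable_fun setT a -> (forall x, `|a x| <= 1) ->
  measurable_fun setT u -> measurable_fun setT w ->
  (\int[mu \x mu]_z
     (a z.1 * (w z.1 \in r)%:R * (N z * D (w z.1) (u z.2)))%:E
   <= (size r)%:R%:E * norm_infty1 mu N)%E.
Proof.
move=> mN N1 + + mu_ mw; elim: r a => [|c r IH] a ma a1.
  rewrite mul0e; under eq_integral do rewrite mulr0 mul0r.
  by rewrite integral0.
have m1 (h : I -> R) : measurable_fun setT h ->
    measurable_fun setT (fun z : I * I => h z.1).
  by move=> mh; exact: measurableT_comp.
have m2 (h : I -> R) : measurable_fun setT h ->
    measurable_fun setT (fun z : I * I => h z.2).
  by move=> mh; exact: measurableT_comp.
(* The value c is split off from a: the part of a where w = c is the test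
   function ac, and the induction hypothesis is applied to the rest, a'. *)
pose ac x := a x * (w x \in [:: c])%:R.
pose b y := D c (u y).
pose a' x := a x * (w x \notin [:: c])%:R.
have mac : measurable_fun setT ac.
  by apply: measurable_funM => //; exact: measurable_mem_seq.
have ma' : measurable_fun setT a'.
  rewrite (_ : a' = fun x => a x - ac x).
    exact: measurable_funB.
  by apply/funext => x; rewrite /a' /ac; case: (w x \in _) => /=; lra.
have bool1 (e : bool) : `|e%:R : R| <= 1 by case: e; rewrite ?normr1 ?normr0.
have ac1 x : `|ac x| <= 1 by rewrite normrM mulr_ile1.
have a'1 x : `|a' x| <= 1 by rewrite normrM mulr_ile1.
have mb : measurable_fun setT b by exact: measurable_interaction.
have b1 y : `|b y| <= 1 by exact: D_bounded.
rewrite (eq_integral (fun z => (ac z.1 * b z.2 * N z)%:E +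
   (a' z.1 * (w z.1 \in r)%:R * (N z * D (w z.1) (u z.2)))%:E)%E); last first.
  move=> z _; rewrite -EFinD; congr EFin; rewrite /ac /a' /b !inE.
  by case: eqVneq => [->|] /=; case: (_ \in r) => /=; lra.
rewrite integralD//.
- rewrite /= -add1n natrD EFinD ge0_muleDl ?lee_fin//.
  rewrite mul1e; apply: leeD; last exact: (IH a').
  exact: integral_test_le_norm_infty1.
- apply: (@bounded_integrable _ _ _ _ (fun z => ac z.1 * b z.2 * N z) 1) => //.
    by do 2?apply: measurable_funM => //; [exact: m1|exact: m2].
  by move=> z; rewrite !normrM !mulr_ile1// mulr_ge0.
- apply: (@bounded_integrable _ _ _ _
    (fun z => a' z.1 * (w z.1 \in r)%:R * (N z * D (w z.1) (u z.2))) 1) => //.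
    apply: measurable_funM.
      apply: (m1 (fun x => a' x * (w x \in r)%:R)).
      by apply: measurable_funM => //; exact: measurable_mem_seq.
    apply: measurable_funM => //; apply: measurable_interaction.
      exact: m1.
    exact: m2.
  by move=> z; rewrite !normrM !mulr_ile1// mulr_ge0.
Qed.

Lemma measurable_coupling (W : I * I -> R) (u : I -> R) :
  measurable_fun setT W -> (forall z, `|W z| <= 1) -> measurable_fun setT u ->
  measurable_fun setT (coupling W u).
Proof.
move=> mW W1 mu_; apply: (@measurable_Rintegral_snd _ _ _ _
   (fun z => W z * D (u z.1) (u z.2)) 1).
  apply: measurable_funM => //; apply: measurable_interaction;
  exact: measurableT_comp.
by move=> z; rewrite normrM mulr_ile1.
Qed.

(** The coupling term Z is tested against itself, and u is replaced by w in
    the first argument of D; since |Z| and |N| are at most 1, the Lipschitz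
    bound on D makes the error linear in |u - w|_1. *)
Lemma coupling_sqr_le (N : I * I -> R) (u w : I -> R) (r : seq R) :
  measurable_fun setT N -> (forall z, `|N z| <= 1) ->
  measurable_fun setT u -> measurable_fun setT w -> (forall x, w x \in r) ->
  mu.-integrable setT (fun x => (u x - w x)%:E) ->
  (\int[mu]_x (coupling N u x ^+ 2)%:E <=
     (size r)%:R%:E * norm_infty1 mu N +
     LD%:E * \int[mu]_x `|u x - w x|%:E)%E.
Proof.
move=> mN N1 mu_ mw wr iuw.
pose Z := coupling N u.
pose K z := N z * D (w z.1) (u z.2).
have mK : measurable_fun setT K.
  apply: measurable_funM => //; apply: measurable_interaction;
  exact: measurableT_comp.
have K1 z : `|K z| <= 1 by rewrite normrM mulr_ile1.
have mZ : measurable_fun setT Z by exact: measurable_coupling.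
have mNx x : measurable_fun setT (fun y => N (x, y)) by exact: measurable_fun_pair2.
have mDx c : measurable_fun setT (fun y => D c (u y)).
  exact: measurable_interaction.
have Z1 x : `|Z x| <= 1.
  apply: le_normr_Rintegral_bound.
    exact: measurable_funM.
  by move=> y; rewrite normrM mulr_ile1.
have mZw : measurable_fun setT (fun x => \int[mu]_y K (x, y)).
  exact: measurable_Rintegral_snd K1.
have Zw1 x : `|\int[mu]_y K (x, y)| <= 1.
  by apply: le_normr_Rintegral_bound => // ; exact: measurable_fun_pair2.
have iND x c : mu.-integrable setT (EFin \o (fun y => N (x, y) * D c (u y))).
  apply: (@bounded_integrable _ _ _ _ _ 1); first exact: measurable_funM.
  by move=> y; rewrite normrM mulr_ile1.
have ZB x : `|Z x - \int[mu]_y K (x, y)| <= LD * `|u x - w x|.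
  rewrite /Z /coupling /K/= -RintegralB//.
  apply: le_normr_Rintegral_bound => [|y].
    by apply: measurable_funB; exact: measurable_funM.
  rewrite -mulrBr normrM -[leRHS]mul1r ler_pM//.
  by have := D_lipschitz (u x) (u y) (w x) (u y); rewrite subrr normr0 addr0.
have iuw' : mu.-integrable setT (fun x => (LD * `|u x - w x|)%:E).
  have := integrableZl measurableT LD (integrable_norm iuw).
  by apply: eq_integrable.
apply: (@le_trans _ _ (\int[mu]_x ((Z x * \int[mu]_y K (x, y))%:E +
    (LD * `|u x - w x|)%:E))%E).
  apply: le_integral => //.
  - apply: (@bounded_integrable _ _ _ _ (fun x => Z x ^+ 2) 1).
      exact: measurable_funX.
    by move=> x; rewrite normrX expr_le1.
  - apply: integrableD => //.
    apply: (@bounded_integrable _ _ _ _ _ 1); first exact: measurable_funM.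
    by move=> x; rewrite normrM mulr_ile1.
  - move=> x _; rewrite -EFinD lee_fin -lerBlDl expr2 -mulrBr.
    rewrite (le_trans (ler_norm _))// normrM -[leRHS]mul1r.
    by rewrite ler_pM.
rewrite integralD//; last first.
  apply: (@bounded_integrable _ _ _ _ _ 1); first exact: measurable_funM.
  by move=> x; rewrite normrM mulr_ile1.
apply: leeD.
  rewrite (Rintegral_fubini mu mZ mK Z1 K1).
  apply: le_trans (pairing_step_le r mN N1 mZ Z1 mu_ mw).
  by under [leRHS]eq_integral do rewrite wr mulr1.
under eq_integral do rewrite EFinM.
rewrite ge0_integralZl//.
- apply/measurable_EFinP; apply: measurableT_comp => //.
  exact: measurable_funB.
- by rewrite lee_fin lipschitz_const_ge0.
Qed.

End coupling.

(** * A Gronwall inequality for increments *)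

(** The hypothesis says that the upper Dini derivatives of E are at most
    L * E + delta in absolute value, which is all that is available for the norm
    of a differentiable curve. The comparison function phi solves
    phi' = (L + 1) phi, and as phi is at least delta + eta its slope dominates
    L * phi + delta + eta, so E cannot cross it. The exponent L + 1 instead of L
    avoids dividing by L. *)
Lemma dini_gronwall (R : realType) (E : R -> R) (T L delta : R) :
  0 <= L -> 0 <= delta ->
  (forall t, 0 <= t <= T -> 0 <= E t) ->
  (forall t eta, 0 <= t <= T -> 0 < eta ->
    \forall r \near t, 0 <= r <= T ->
      `|E r - E t| <= `|r - t| * (L * E t + delta + eta)) ->
  forall t, 0 <= t <= T -> E t <= (E 0 + delta) * expR ((L + 1) * t).
Proof.
move=> L0 delta0 E0 Edini t tT.
have T0 : 0 <= T by lra.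
apply/ler_addgt0Pr => e e0.
pose eta := e / expR ((L + 1) * t).
have eta0 : 0 < eta by rewrite divr_gt0// expR_gt0.
pose phi r := (E 0 + delta + eta) * expR ((L + 1) * r).
have phi00 : 0 < E 0 + delta + eta by have := E0 0; lra.
suff : E t <= phi t.
  move/le_trans; apply; rewrite /phi mulrDl lerD2l /eta divfK//.
  by rewrite gt_eqF// expR_gt0.
have phi_gt0 r : 0 < phi r by rewrite mulr_gt0// expR_gt0.
have phiD r h : 0 <= h -> phi r * (1 + (L + 1) * h) <= phi (r + h).
  move=> h0; rewrite /phi (mulrDr (L + 1) r h) expRD mulrA ler_wpM2l// ?expR_ge1Dx//.
  exact/ltW/phi_gt0.
have phi_le r h : 0 <= h -> phi r <= phi (r + h).
  move=> h0; apply: le_trans (phiD r h h0); rewrite ler_peMr ?(ltW (phi_gt0 r))//.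
  have Lh : 0 <= (L + 1) * h by rewrite mulr_ge0//; lra.
  by lra.
have phi_ge r : 0 <= r -> delta + eta <= phi r.
  move=> r0; have := phi_le 0 r r0; rewrite add0r; apply: le_trans.
  by rewrite /phi mulr0 expR0 mulr1; have := E0 0; lra.
have Edini_ball r : 0 <= r <= T -> exists2 eps : R, 0 < eps &
    forall q, 0 <= q <= T -> `|q - r| < eps ->
      `|E q - E r| <= `|q - r| * (L * E r + delta + eta).
  move=> rT; have [eps /= eps0 H] := (nbhs_ballP _ _).1 (Edini r eta rT eta0).
  by exists eps => // q qT qr; apply: H => //; rewrite /ball/= distrC.
(* S is the end of the longest initial interval on which E <= phi. *)
pose A := [set r | 0 <= r <= T /\ forall q, 0 <= q <= r -> E q <= phi q].
have A0 : A 0.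
  split; first by lra.
  move=> q q0; have -> : q = 0 by lra.
  by rewrite /phi mulr0 expR0 mulr1; lra.
have supA : has_sup A.
  by split; [exists 0 | exists T => r [rT _]; lra].
pose S := sup A.
have S0 : 0 <= S by apply: sup_upper_bound.
have ST : S <= T by apply: ge_sup => //; [exists 0|move=> r [rT _]; lra].
have belowS q : 0 <= q -> q < S -> E q <= phi q.
  move=> q0 qS; have qS0 : 0 < S - q by lra.
  have [a [_ Ha] aq] := sup_adherent qS0 supA.
  by apply: Ha; rewrite -/S in aq; lra.
(* If E were above phi at S, it would already be above phi a little to the
   left of S, at a distance h with h * C below the gap. *)
have ES : E S <= phi S.
  rewrite leNgt; apply/negP => gap.
  have Sgt0 : 0 < S.
    rewrite lt_neqAle S0 andbT; apply/eqP => S00.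
    by move: gap; rewrite -S00 /phi mulr0 expR0 mulr1; lra.
  have [|eps eps0 H] := Edini_ball S; first by lra.
  pose C := L * E S + delta + eta.
  have C0 : 0 <= C.
    have : 0 <= L * E S by rewrite mulr_ge0// E0//; lra.
    by rewrite /C; lra.
  pose g := (E S - phi S) / (C + 1).
  have g0 : 0 < g by rewrite divr_gt0//; lra.
  have gC : g * C < E S - phi S.
    have : g * (C + 1) = E S - phi S by rewrite divfK//; apply/eqP; lra.
    by lra.
  pose h := Num.min eps (Num.min S g) / 2.
  have m0 : 0 < Num.min eps (Num.min S g) by rewrite !lt_min eps0 Sgt0.
  have [he hS hg] : [/\ h < eps, h < S & h < g].
    have hm : h < Num.min eps (Num.min S g) by rewrite /h; lra.
    by move: hm; rewrite !lt_min => /and3P[].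
  have h0 : 0 < h by rewrite divr_gt0.
  have := H (S - h); rewrite (_ : S - h - S = - h); last by lra.
  rewrite normrN gtr0_norm// => /(_ _ he).
  have -> : 0 <= S - h <= T by lra.
  move=> /(_ isT); rewrite -/C distrC => /(le_trans (ler_norm _)) EhC.
  have hC : h * C <= g * C by rewrite ler_wpM2r// ltW.
  have := phi_le (S - h) h (ltW h0); rewrite subrK.
  have : E (S - h) <= phi (S - h) by apply: belowS; lra.
  by lra.
have [ST_eq|S_neq_T] := eqVneq S T.
  rewrite ST_eq in ES belowS.
  have [->//|tneqT] := eqVneq t T.
  by apply: belowS; [lra|rewrite lt_neqAle tneqT; lra].
(* The bound on increments carries E <= phi past S. *)
exfalso.
have SltT : S < T by rewrite lt_neqAle S_neq_T.
have [|eps eps0 H] := Edini_ball S; first by lra.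
pose h := Num.min eps (T - S) / 2.
have m0 : 0 < Num.min eps (T - S) by rewrite lt_min eps0 subr_gt0.
have [he hT] : h < eps /\ h < T - S.
  have hm : h < Num.min eps (T - S) by rewrite /h; lra.
  by move: hm; rewrite lt_min => /andP[].
have h0 : 0 < h by rewrite divr_gt0.
suff : A (S + h) by move/(sup_upper_bound supA); rewrite -/S; lra.
split; first by lra.
move=> q qSh; have [qS|Sq] := ltP q S; first by apply: belowS => //; lra.
have k0 : 0 <= q - S by lra.
have := phiD S (q - S) k0; rewrite subrKC; apply: le_trans.
have := H q; rewrite ger0_norm// => /(_ _ _).
have -> : 0 <= q <= T by lra.
have -> : q - S < eps by lra.
move=> /(_ isT isT) /(le_trans (ler_norm _)) Eq.
have LE : L * E S <= L * phi S by rewrite ler_wpM2l.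
have dphi := phi_ge S S0.
have : (q - S) * (L * E S + delta + eta) <= (q - S) * ((L + 1) * phi S).
  by rewrite ler_wpM2l//; lra.
by lra.
Qed.

(** * Uniformity in time and relabelling *)

Lemma ereal_nbhs0_lt {R : realType} {e : R} : 0 < e ->
  nbhs (0 : \bar R)%E [set x | (x < e%:E)%E].
Proof.
move=> e0; apply: open_nbhs_nbhs; split; first exact: open_ereal_lt_ereal.
by rewrite /= lte_fin.
Qed.

Section uniform_smallness.
Import HBSimple.
Context d (I : measurableType d) (R : realType) (mu : probability I R).
Context (D : R -> R -> R) (LD : R).
Context (mD : measurable_fun setT (fun z : R * R => D z.1 z.2)).
Context (D_bounded : forall u v, `|D u v| <= 1).
Context (D_lipschitz : forall u v u' v',
    `|D u v - D u' v'| <= LD * (`|u - u'| + `|v - v'|)).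
Local Notation N f := ('N[mu]_2%:E [ (fun x => (f x)%:E) ])%E.

Lemma L2norm_lty_integrable (f : I -> R) : measurable_fun setT f ->
  (N f < +oo)%E -> mu.-integrable setT (EFin \o f).
Proof.
move=> mf Nf; apply/integrableP; split; first exact/measurable_EFinP.
exact: le_lt_trans (L1_le_L2 mu mf) Nf.
Qed.

Lemma step_approx (f : I -> R) (eta : R) : mu.-integrable setT (EFin \o f) ->
  0 < eta -> exists (w : I -> R) (r : seq R),
    [/\ measurable_fun setT w, forall x, w x \in r &
        (\int[mu]_x `|f x - w x|%:E < eta%:E)%E].
Proof.
move=> intf eta0.
have [g [_ _ g0]] := approximation_sfun_integrable measurableT intf.
have [n _ /(_ n (leqnn n)) gn] := g0 _ (ereal_nbhs0_lt eta0).
have /finite_seqP[r gr] := fimfunP (g n).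
exists (g n), r; split => // x.
have : range (g n) (g n x) by exists x.
by rewrite gr.
Qed.

(** Around each time t0 one step function w close to u t0 serves for all
    nearby times and, composed with s, for all relabellings: integrals against
    mu and the list of values are not affected by s. The kernel K is bounded by
    1 because it will be a difference of two graphons. *)
Lemma coupling_uniformly_small (T : R) (u : L2path mu T) (delta : R) : 0 < delta ->
  exists2 rho : R, 0 < rho & forall t, 0 <= t <= T ->
    forall s, measure_preserving_bijection mu s ->
    forall K : I * I -> R, measurable_fun setT K -> (forall z, `|K z| <= 1) ->
    (norm_infty1 mu K < rho%:E)%E ->
    (N (coupling mu D K (u t \o s)) <= delta%:E)%E.
Proof.
move=> delta0.
have LD0 := lipschitz_const_ge0 D_lipschitz.
pose small rho t := forall s, measure_preserving_bijection mu s ->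
  forall K : I * I -> R, measurable_fun setT K -> (forall z, `|K z| <= 1) ->
  (norm_infty1 mu K < rho%:E)%E ->
  (N (coupling mu D K (u t \o s)) <= delta%:E)%E.
have cover : \forall rho \near 0^'+, `[0, T] `<=` small rho.
  have /compact_near_coveringP/near_covering_withinP := @segment_compact R 0 T.
  apply => t0 /=; rewrite in_itv/= => t0T.
  (* The squared norm delta ^+ 2 is shared equally: LD * (2 * eta) is at most
     one half for the step approximation, size r * rho0 at most the other half
     for the kernel. *)
  pose eta := delta ^+ 2 / (4 * (LD + 1)).
  have eta0 : 0 < eta by rewrite divr_gt0 ?exprn_gt0// mulr_gt0//; lra.
  have ut0 : mu.-integrable setT (EFin \o u t0).
    by apply: L2norm_lty_integrable => //; exact: Lfunction_finite.
  have [w [r [mw wr uw]]] := step_approx ut0 eta0.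
  pose rho0 := delta ^+ 2 / (2 * ((size r)%:R + 1)).
  have rho00 : 0 < rho0 by rewrite divr_gt0 ?exprn_gt0// mulr_gt0// ltr_wpDl.
  have ut : \forall t \near t0, 0 <= t <= T ->
      (L2dist mu (u t) (u t0) < eta%:E)%E.
    have : nbhs t0 (fun t => `[0, T]%classic t ->
      (L2dist mu (u t) (u t0) < eta%:E)%E) :=
      L2path_continuous u t0T (ereal_nbhs0_lt eta0).
    apply: filterS => t ut tT; apply: ut.
    by rewrite /= in_itv.
  near=> t rho => /= tT s Ps K mK K1 Krho.
  have mut : measurable_fun setT (u t) by [].
  have utt0 : (L2dist mu (u t) (u t0) < eta%:E)%E.
    by move: tT; rewrite in_itv/=; near: t; exact: ut.
  have utw : (\int[mu]_x `|u t x - w x|%:E <= (2 * eta)%:E)%E.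
    apply: (@le_trans _ _ (\int[mu]_x (`|u t x - u t0 x|%:E + `|u t0 x - w x|%:E))%E).
      apply: ge0_le_integral => //.
      - apply/measurable_EFinP; apply: measurableT_comp => //.
        exact: measurable_funB.
      - by apply: emeasurable_funD; apply/measurable_EFinP; apply: measurableT_comp => //;
          exact: measurable_funB.
      - by move=> x _; rewrite -EFinD lee_fin ler_distD.
    rewrite ge0_integralD//; last 2 first.
      by apply/measurable_EFinP; apply: measurableT_comp => //; exact: measurable_funB.
      by apply/measurable_EFinP; apply: measurableT_comp => //; exact: measurable_funB.
    have -> : (2 * eta)%:E = (eta%:E + eta%:E)%E.
      by rewrite -EFinD; congr EFin; lra.
    apply: leeD; last exact: ltW.
    by apply: le_trans (ltW utt0); apply: L1_le_L2; exact: measurable_funB.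
  apply: L2norm_le_sqr; first exact: ltW.
  have [_ ms _ _] := Ps.
  have mus : measurable_fun setT (u t \o s) by exact: measurableT_comp.
  have mws : measurable_fun setT (w \o s) by exact: measurableT_comp.
  have E : (\int[mu]_x `|(u t \o s) x - (w \o s) x|%:E =
            \int[mu]_x `|u t x - w x|%:E)%E.
    apply: (integral_mpb Ps (f := fun x => `|u t x - w x|%:E)).
    by apply/measurable_EFinP; apply: measurableT_comp => //; exact: measurable_funB.
  apply: le_trans (@coupling_sqr_le _ _ _ mu D LD mD D_bounded D_lipschitz
    K (u t \o s) (w \o s) r mK K1 mus mws _ _) _ => //.
    by move=> x; exact: wr.
    apply/integrableP; split.
      by apply/measurable_EFinP; exact: measurable_funB.
    by rewrite /= E (le_lt_trans utw)// ltry.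
  rewrite E.
  have -> : (delta ^+ 2)%:E =
      (delta ^+ 2 / 2)%:E + (delta ^+ 2 / 2)%:E :> \bar R.
    by rewrite -EFinD; congr EFin; lra.
  apply: leeD.
    apply: (@le_trans _ _ ((size r)%:R%:E * rho%:E)%E).
      by rewrite lee_wpmul2l ?lee_fin// ltW.
    rewrite -EFinM lee_fin.
    have rr : rho <= rho0.
      by near: rho; exact: nbhs_right_le.
    apply: (@le_trans _ _ ((size r)%:R * rho0)); first by rewrite ler_wpM2l.
    rewrite /rho0 mulrA ler_pdivrMr; last by rewrite mulr_gt0// ltr_wpDl.
    have : 0 <= delta ^+ 2 by exact: exprn_ge0 (ltW delta0).
    by lra.
  apply: (@le_trans _ _ (LD%:E * (2 * eta)%:E)%E).
    by rewrite lee_wpmul2l ?lee_fin.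
  rewrite -EFinM lee_fin.
  have E4 : eta * (4 * (LD + 1)) = delta ^+ 2.
    by rewrite divfK//; apply/eqP; lra.
  by lra.
have [rho [/= rho0 H]] : exists rho : R, 0 < rho /\ `[0, T] `<=` small rho.
  near (0 : R)^'+ => rho.
  exists rho; split; first by near: rho; exact: nbhs_right_gt.
  by near: rho.
by exists rho => // t tT; apply: H; rewrite /= in_itv.
Unshelve. all: by end_near. Qed.

End uniform_smallness.

(** * Stability of solutions *)

Lemma lipschitz_continuous (R : realType) (g : R -> R) (L : R) :
  (forall u v, `|g u - g v| <= L * `|u - v|) -> continuous g.
Proof.
move=> gL x; apply/cvgrPdist_lt => e e0.
have L0 : 0 <= L.
  by have := gL 1 0; rewrite subr0 normr1 mulr1; apply: le_trans.
have L1 : 0 < L + 1 by lra.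
near=> y; apply: le_lt_trans (gL _ _) _.
have xy : `|x - y| <= e / (L + 1).
  by near: y; apply: cvgr_dist_le => //; rewrite divr_gt0.
apply: (@le_lt_trans _ _ (L * (e / (L + 1)))); first by rewrite ler_wpM2l.
by rewrite mulrA ltr_pdivrMr// mulrDr mulr1 mulrC ltrDl.
Unshelve. all: by end_near. Qed.

Section stability.
Context d (I : measurableType d) (R : realType) (mu : probability I R).
Context (f D : R -> R -> R) (Lf LD : R).
Context (f_lipschitz : forall u v t, `|f u t - f v t| <= Lf * `|u - v|).
Context (mD : measurable_fun setT (fun z : R * R => D z.1 z.2)).
Context (D_bounded : forall u v, `|D u v| <= 1).
Context (D_lipschitz : forall u v u' v',
    `|D u v - D u' v'| <= LD * (`|u - u'| + `|v - v'|)).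
Local Notation N f := ('N[mu]_2%:E [ (fun x => (f x)%:E) ])%E.
Local Notation coupling := (coupling mu D).

(** The difference of kernels is coupled with u alone: in the application u is
    the fixed solution, for which smallness of the coupling is known. *)
Lemma coupling_diff_le (U V : I * I -> R) (u v : I -> R) (x : I) :
  measurable_fun setT U -> measurable_fun setT V ->
  (forall z, `|U z| <= 1) -> (forall z, `|V z| <= 1) ->
  measurable_fun setT u -> measurable_fun setT v ->
  mu.-integrable setT (fun x => (u x - v x)%:E) ->
  `|coupling U u x - coupling V v x| <=
    `|coupling (fun z => U z - V z) u x| +
    LD * (`|u x - v x| + \int[mu]_y `|u y - v y|).
Proof.
move=> mU mV U1 V1 mu_ mv iuv.
have mDx c (w : I -> R) : measurable_fun setT w ->
    measurable_fun setT (fun y => D c (w y)).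
  by move=> mw; exact: measurable_interaction.
have mWx (W : I * I -> R) : measurable_fun setT W ->
    measurable_fun setT (fun y => W (x, y)).
  by move=> mW; exact: measurable_fun_pair2.
have iWD (W : I * I -> R) c w : measurable_fun setT W ->
    (forall z, `|W z| <= 1) -> measurable_fun setT w ->
    mu.-integrable setT (EFin \o (fun y => W (x, y) * D c (w y))).
  move=> mW W1 mw; apply: (@bounded_integrable _ _ _ _ _ 1).
    by apply: measurable_funM; [exact: mWx|exact: mDx].
  by move=> y; rewrite normrM mulr_ile1.
have splitUV : coupling U u x - coupling V v x =
    coupling (fun z => U z - V z) u x +
    \int[mu]_y (V (x, y) * D (u x) (u y) - V (x, y) * D (v x) (v y)).
  rewrite RintegralB//; [|exact: iWD|exact: iWD].
  rewrite /coupling (_ : (fun y => (U (x, y) - V (x, y)) * D (u x) (u y)) =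
    (fun y => U (x, y) * D (u x) (u y) - V (x, y) * D (u x) (u y))); last first.
    by apply/funext => y; rewrite mulrBl.
  rewrite RintegralB//; [|exact: iWD|exact: iWD].
  by lra.
rewrite splitUV (le_trans (ler_normD _ _))// lerD2l.
have iabs : mu.-integrable setT (EFin \o (fun y => `|u y - v y|)).
  exact: integrable_norm iuv.
have iVDD : mu.-integrable setT (EFin \o
    (fun y => V (x, y) * D (u x) (u y) - V (x, y) * D (v x) (v y))).
  exact: (integrableB measurableT (iWD V (u x) u mV V1 mu_) (iWD V (v x) v mV V1 mv)).
have iconst : mu.-integrable setT (EFin \o (fun=> `|u x - v x|)).
  apply: (@bounded_integrable _ _ _ mu (fun=> `|u x - v x|) `|u x - v x|) => // y.
  by rewrite normr_id.
have isum : mu.-integrable setT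
    (EFin \o (fun y => `|u x - v x| + `|u y - v y|)).
  exact: (integrableD measurableT iconst iabs).
apply: le_trans (le_normr_Rintegral measurableT iVDD) _.
apply: (@le_trans _ _ (\int[mu]_y (LD * (`|u x - v x| + `|u y - v y|)))).
  apply: le_Rintegral => //.
  - exact: integrable_norm iVDD.
  - exact: (integrableZl measurableT LD isum).
  - move=> y _; rewrite -mulrBr normrM -[leRHS]mul1r ler_pM//.
rewrite RintegralZl// RintegralD//.
by rewrite Rintegral_cst// [X in fine X](probability_setT mu) mulr1.
Qed.

Lemma measurable_reaction (t : R) (u : I -> R) : measurable_fun setT u ->
  measurable_fun setT (fun x => f (u x) t).
Proof.
move=> mu_; apply: (@measurableT_comp _ _ _ _ _ _ (f ^~ t)) => //.
apply: continuous_measurable_fun.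
by apply: (@lipschitz_continuous _ _ Lf) => v w; exact: f_lipschitz.
Qed.

Lemma reaction_lipschitz_ge0 : 0 <= Lf.
Proof.
by have := f_lipschitz 1 0 0; rewrite subr0 normr1 mulr1; apply: le_trans.
Qed.

Lemma rhs_dist_le (U V : I * I -> R) (u v : I -> R) (t : R) :
  measurable_fun setT U -> measurable_fun setT V ->
  (forall z, `|U z| <= 1) -> (forall z, `|V z| <= 1) ->
  (forall z, `|U z - V z| <= 1) ->
  measurable_fun setT u -> measurable_fun setT v ->
  mu.-integrable setT (fun x => (u x - v x)%:E) ->
  (L2dist mu (fun x => f (u x) t + coupling U u x)%R
             (fun x => f (v x) t + coupling V v x)%R <=
   (Lf + 2 * LD)%:E * L2dist mu u v + N (coupling (fun z => U z - V z)%R u))%E.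
Proof.
move=> mU mV U1 V1 UV1 mu_ mv iuv.
have Lf0 := reaction_lipschitz_ge0.
have LD0 := lipschitz_const_ge0 D_lipschitz.
have mh : measurable_fun setT (fun x => `|u x - v x|).
  by apply: measurableT_comp => //; exact: measurable_funB.
pose Z := coupling (fun z => U z - V z) u.
pose m := \int[mu]_y `|u y - v y|.
have m0 : 0 <= m by apply: Rintegral_ge0.
have mZ : measurable_fun setT (fun x => `|Z x|).
  apply: measurableT_comp => //; apply: measurable_coupling => //.
  exact: measurable_funB.
have mA (W : I * I -> R) (w : I -> R) : measurable_fun setT W ->
    (forall z, `|W z| <= 1) ->
    measurable_fun setT w ->
    measurable_fun setT (fun x => f (w x) t + coupling W w x).
  move=> mW W1 mw; apply: measurable_funD; first exact: measurable_reaction.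
  exact: measurable_coupling.
have m_le : (m%:E <= L2dist mu u v)%E.
  rewrite /m /Rintegral fineK; last first.
    by apply: integrable_fin_num => //; exact: integrable_norm iuv.
  by apply: L1_le_L2; exact: measurable_funB.
apply: (@le_trans _ _ (N (fun x => (Lf + LD) * `|u x - v x| +
    (`|Z x| + LD * m))%R)).
  apply: L2norm_le => [||x].
  - by apply: measurable_funB; exact: mA.
  - apply: measurable_funD; first exact: measurable_funM.
    exact: measurable_funD.
  - rewrite [leRHS]ger0_norm; last first.
      by rewrite !addr_ge0// mulr_ge0// addr_ge0.
    have -> : f (u x) t + coupling U u x - (f (v x) t + coupling V v x) =
       (f (u x) t - f (v x) t) + (coupling U u x - coupling V v x) by lra.
    apply: le_trans (ler_normD _ _) _.
    have := f_lipschitz (u x) (v x) t.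
    have := coupling_diff_le x mU mV U1 V1 mu_ mv iuv.
    by rewrite -/Z -/m; lra.
apply: le_trans (L2normD mu _ _) _.
- exact: measurable_funM.
- exact: measurable_funD.
apply: (@le_trans _ _ ((Lf + LD)%:E * L2dist mu u v +
    (N Z + LD%:E * L2dist mu u v))%E).
  apply: leeD.
    rewrite L2normZ// ger0_norm ?addr_ge0// lee_wpmul2l ?lee_fin ?addr_ge0//.
    apply: L2norm_le => // [|x]; first exact: measurable_funB.
    by rewrite normr_id.
  apply: le_trans (L2normD mu mZ (measurable_cst _)) _.
  apply: leeD.
    apply: L2norm_le => // [|x]; last by rewrite normr_id.
    by apply: measurable_coupling => //; exact: measurable_funB.
  rewrite L2norm_cst ger0_norm ?mulr_ge0// EFinM.
  by rewrite lee_wpmul2l ?lee_fin.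
rewrite (addeC (N Z)) addeA leeD2r//.
rewrite -ge0_muleDl ?lee_fin ?addr_ge0// -EFinD.
by rewrite (_ : Lf + LD + LD = Lf + 2 * LD)//; lra.
Qed.

(** Solutions as plain families of functions: relabelled paths u t \o s, which
    are not bundled as elements of the path space, are covered too. *)
Definition L2_solution (W : I * I -> R) (T : R) (u : R -> I -> R) :=
  [/\ forall t, measurable_fun setT (u t),
      forall t, (N (u t) < +oo)%E &
      forall t, 0 <= t <= T ->
        L2dist mu (fun x => (u r x - u t x) / (r - t))
                  (fun x => f (u t x) t + coupling W (u t) x)
          @[r --> within `[0, T] t^'] --> 0%E].

Lemma L2norm_lty_fine (g : I -> R) : (N g < +oo)%E -> ((fine (N g))%:E = N g)%E.
Proof. by move=> Ng; rewrite fineK// ge0_fin_numE// Lnorm_ge0. Qed.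

(** The triangle inequality in both directions; k is h moved by c times the
    velocity G, so this bounds the increment of the norm along a curve. *)
Lemma L2norm_increment_le (h k G : I -> R) (c : R) :
  measurable_fun setT h -> measurable_fun setT G ->
  (N h < +oo)%E -> (N G < +oo)%E ->
  (forall x, k x = h x + c * G x) ->
  `|fine (N k) - fine (N h)| <= `|c| * fine (N G).
Proof.
move=> mh mG Nh NG khG.
have mcG : measurable_fun setT (fun x => c * G x) by exact: measurable_funM.
have mk : measurable_fun setT k.
  by rewrite (_ : k = fun x => h x + c * G x); [exact: measurable_funD|exact/funext].
have le1 : (N k <= N h + `|c|%:E * N G)%E.
  rewrite -L2normZ//; apply: le_trans (L2normD mu mh mcG).
  by rewrite (eq_Lnorm mu _ (g := fun x => (h x + c * G x)%:E))// => x; rewrite khG.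
have le2 : (N h <= N k + `|c|%:E * N G)%E.
  have mcG' : measurable_fun setT (fun x => - c * G x) by exact: measurable_funM.
  rewrite -normrN -L2normZ//; apply: le_trans (L2normD mu mk mcG').
  rewrite (eq_Lnorm mu _ (g := fun x => (k x + - c * G x)%:E))// => x.
  by rewrite khG; congr EFin; lra.
have Nk : (N k < +oo)%E.
  apply: le_lt_trans le1 _; rewrite -(L2norm_lty_fine Nh) -(L2norm_lty_fine NG).
  by rewrite -EFinM -EFinD ltry.
move: le1 le2; rewrite -(L2norm_lty_fine Nh) -(L2norm_lty_fine NG) -(L2norm_lty_fine Nk).
rewrite -!EFinM -!EFinD !lee_fin/= => le1 le2.
by rewrite ler_norml; apply/andP; split; lra.
Qed.

Lemma L2_solution_stability (U V : I * I -> R) (T delta : R) (u v : R -> I -> R) :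
  measurable_fun setT U -> measurable_fun setT V ->
  (forall z, `|U z| <= 1) -> (forall z, `|V z| <= 1) ->
  (forall z, `|U z - V z| <= 1) ->
  L2_solution U T u -> L2_solution V T v -> 0 <= delta ->
  (forall t, 0 <= t <= T ->
     (N (coupling (fun z => U z - V z)%R (u t)) <= delta%:E)%E) ->
  forall t, 0 <= t <= T ->
  (L2dist mu (u t) (v t) <=
   ((fine (L2dist mu (u 0) (v 0)) + delta) *
    expR ((Lf + 2 * LD + 1) * t))%:E)%E.
Proof.
move=> mU mV U1 V1 UV1 [mu_ Nu du] [mv Nv dv] delta0 small t tT.
have Lf0 := reaction_lipschitz_ge0.
have LD0 := lipschitz_const_ge0 D_lipschitz.
have mh r : measurable_fun setT (fun x => u r x - v r x).
  exact: measurable_funB.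
have Nh r : (L2dist mu (u r) (v r) < +oo)%E.
  rewrite /L2dist (eq_Lnorm mu _ (g := fun x => (u r x + -1 * v r x)%:E)); last first.
    by move=> x; congr EFin; lra.
  apply: le_lt_trans (L2normD mu (mu_ r) _) _; first exact: measurable_funM.
  rewrite L2normZ// normrN1 mul1e.
  by rewrite -(L2norm_lty_fine (Nu r)) -(L2norm_lty_fine (Nv r)) -EFinD ltry.
have Eh r : ((fine (L2dist mu (u r) (v r)))%:E = L2dist mu (u r) (v r))%E.
  exact: (L2norm_lty_fine (Nh r)).
rewrite -Eh lee_fin.
apply: (@dini_gronwall R (fun r => fine (L2dist mu (u r) (v r))) T) => //.
- by rewrite addr_ge0// mulr_ge0.
- by move=> r _; exact/fine_ge0/Lnorm_ge0.
move=> {}t eta {}tT eta0.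
(* Write u r - v r = (u t - v t) + (r - t) G with
   G = (qu - A) + (A - B) - (qv - B): the outer terms vanish as r tends to t by
   differentiability, and A - B is bounded by rhs_dist_le. *)
pose A x := f (u t x) t + coupling U (u t) x.
pose B x := f (v t x) t + coupling V (v t) x.
pose qu r x := (u r x - u t x) / (r - t).
pose qv r x := (v r x - v t x) / (r - t).
have mA : measurable_fun setT A.
  apply: measurable_funD; first exact: measurable_reaction.
  exact: measurable_coupling.
have mB : measurable_fun setT B.
  apply: measurable_funD; first exact: measurable_reaction.
  exact: measurable_coupling.
have mqu r : measurable_fun setT (qu r).
  by apply: measurable_funM => //; exact: measurable_funB.
have mqv r : measurable_fun setT (qv r).
  by apply: measurable_funM => //; exact: measurable_funB.
have AB : (L2dist mu A B <=
    ((Lf + 2 * LD) * fine (L2dist mu (u t) (v t)) + delta)%:E)%E.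
  apply: le_trans (rhs_dist_le t
    mU mV U1 V1 UV1 (mu_ t) (mv t) _) _.
    exact: L2norm_lty_integrable (mh t) (Nh t).
  rewrite [in leRHS]EFinD [in leRHS]EFinM Eh.
  by apply: leeD => //; exact: small.
have eta2 : 0 < eta / 2 by rewrite divr_gt0.
have du_near : \forall r \near t, r != t -> `[0, T]%classic r ->
    (L2dist mu (qu r) A < (eta / 2)%:E)%E := du t tT _ (ereal_nbhs0_lt eta2).
have dv_near : \forall r \near t, r != t -> `[0, T]%classic r ->
    (L2dist mu (qv r) B < (eta / 2)%:E)%E := dv t tT _ (ereal_nbhs0_lt eta2).
apply: filterS2 du_near dv_near => r qur qvr rT.
have [->|rt] := eqVneq r t; first by rewrite !subrr normr0 mul0r.
have rT' : `[0, T]%classic r by rewrite /= in_itv.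
move: (qur rt rT') (qvr rt rT') => {}qur {}qvr.
pose G x := (qu r x - A x) + ((A x - B x) + (-1) * (qv r x - B x)).
have mG2 : measurable_fun setT (fun x => (A x - B x) + (-1) * (qv r x - B x)).
  apply: measurable_funD; first exact: measurable_funB.
  by apply: measurable_funM => //; exact: measurable_funB.
have mG : measurable_fun setT G.
  by apply: measurable_funD => //; exact: measurable_funB.
have NG : (N G <= ((Lf + 2 * LD) * fine (L2dist mu (u t) (v t)) + delta + eta)%:E)%E.
  apply: le_trans (L2normD mu _ mG2) _; first exact: measurable_funB.
  apply: (@le_trans _ _ ((eta / 2)%:E +
     (((Lf + 2 * LD) * fine (L2dist mu (u t) (v t)) + delta)%:E + (eta / 2)%:E))%E).
    apply: leeD; first exact: ltW.
    have mqB : measurable_fun setT (fun x => qv r x - B x) by exact: measurable_funB.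
    apply: le_trans (L2normD mu _ _) _; [exact: measurable_funB|exact: measurable_funM|].
    by apply: leeD => //; rewrite L2normZ// normrN1 mul1e; exact: ltW.
  by rewrite -!EFinD lee_fin; lra.
have NGoo : (N G < +oo)%E by apply: le_lt_trans NG _; rewrite ltry.
have := @L2norm_increment_le (fun x => u t x - v t x) (fun x => u r x - v r x) G
  (r - t) (mh t) mG (Nh t) NGoo.
move=> /(_ _)/le_trans; apply.
  move=> x; rewrite /G /qu /qv.
  have rt0 : r - t != 0 by rewrite subr_eq0.
  have -> : (u r x - u t x) / (r - t) - A x +
     (A x - B x + -1 * ((v r x - v t x) / (r - t) - B x)) =
     ((u r x - u t x) - (v r x - v t x)) / (r - t) by rewrite mulrBl; lra.
  by rewrite mulrC divfK//; lra.
rewrite ler_wpM2l//.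
by rewrite -lee_fin (L2norm_lty_fine NGoo).
Qed.

Lemma coupling_reindex (s : I -> I) (W : I * I -> R) (u : I -> R) (x : I) :
  measure_preserving_bijection mu s ->
  measurable_fun setT W -> measurable_fun setT u ->
  coupling (reindex2 s W) (u \o s) x = coupling W u (s x).
Proof.
move=> Ps mW mu_; congr fine.
apply: (integral_mpb Ps (f := fun y => (W (s x, y) * D (u (s x)) (u y))%:E)).
apply/measurable_EFinP; apply: measurable_funM.
  exact: measurable_fun_pair2.
exact: measurable_interaction.
Qed.

Lemma L2_solution_reindex (s : I -> I) (W : I * I -> R) (T : R) (u : R -> I -> R) :
  measure_preserving_bijection mu s ->
  measurable_fun setT W -> (forall z, `|W z| <= 1) -> L2_solution W T u ->
  L2_solution (reindex2 s W) T (fun t => u t \o s).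
Proof.
move=> Ps mW W1 [mu_ Nu du]; have [_ ms _ _] := Ps; split.
- by move=> t; exact: measurableT_comp.
- by move=> t; rewrite (L2norm_mpb Ps).
move=> t tT; rewrite [X in X @ _](_ : _ = (fun r =>
   L2dist mu (fun x => (u r x - u t x) / (r - t))
             (fun x => f (u t x) t + coupling W (u t) x))); first exact: du.
apply/funext => r.
rewrite /L2dist -[in RHS](L2norm_mpb Ps).
  by apply: eq_Lnorm => x /=; rewrite coupling_reindex.
apply: measurable_funB.
  by apply: measurable_funM => //; exact: measurable_funB.
apply: measurable_funD; first exact: measurable_reaction.
exact: measurable_coupling.
Qed.

End stability.

(** * Passing to the quotients *)

Section continuity.
Context d (I : measurableType d) (R : realType) (mu : probability I R).
Local Open Scope quotient_scope.

Lemma norm_infty1_ge0 (N : I * I -> R) : (0 <= norm_infty1 mu N)%E.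
Proof.
have := @integral_test_le_norm_infty1 _ _ _ mu N (fun=> 0) (fun=> 0)
  (measurable_cst _) (measurable_cst _).
under eq_integral do rewrite mul0r mul0r.
by rewrite integral0; apply => x; rewrite normr0.
Qed.

Lemma solves_ivp_L2_solution (f D : R -> R -> R) (T : R) (p : ivp_data mu)
    (u : L2path mu T) :
  solves_ivp f D p u -> L2_solution mu f D p.1 T (fun t => u t).
Proof.
by move=> [_ du]; split => // t; exact: Lfunction_finite.
Qed.

Lemma repr_L2path_rel (T : R) (u : L2path mu T) :
  L2path_rel u (repr (\pi_(L2path_quot mu T) u)).
Proof. by apply/eqmodP; rewrite reprK. Qed.

(** If u = u' o s1 and v' = v o s2 for the chosen representatives u' and v',
    then u o s is compared with v by comparing u' o (s1 o s o s2) with v'. *)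
Lemma L2path_dist_le (T : R) (u v : L2path mu T) (s : I -> I) (b : \bar R) :
  measure_preserving_bijection mu s ->
  (forall t, 0 <= t <= T -> (L2dist mu (u t \o s) (v t) <= b)%E) ->
  (L2path_dist (\pi_(L2path_quot mu T) u) (\pi_(L2path_quot mu T) v) <= b)%E.
Proof.
move=> Ps uv; rewrite /L2path_dist.
have := repr_L2path_rel u; rewrite L2path_rel_sym => /asboolP[s1 Ps1 u1].
have /asboolP[s2 Ps2 v2] := repr_L2path_rel v.
have Pss2 : measure_preserving_bijection mu (s \o s2) by exact: mpb_comp.
apply: ge_ereal_inf.
exists (ereal_sup [set L2dist mu
    (repr (\pi_(L2path_quot mu T) u) t \o (s1 \o (s \o s2)))
    (repr (\pi_(L2path_quot mu T) v) t) | t in [set t | 0 <= t <= T]]).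
  by exists (s1 \o (s \o s2)) => //; exact: mpb_comp.
apply: ge_ereal_sup => _ [t /= tT <-].
apply: le_trans (uv t tT).
have [_ ms _ _] := Ps; have [_ ms1 _ _] := Ps1; have [_ ms2 _ _] := Ps2.
have mus : measurable_fun setT (fun x => u t (s x)).
  exact: (measurableT_comp _ ms).
rewrite /L2dist.
rewrite -(L2norm_mpb Ps2 (f := fun x => u t (s x) - v t x)); last first.
  exact: measurable_funB.
have mLfun (w : LfunType mu (lee1n 2)) (r : I -> I) : measurable_fun setT r ->
    measurable_fun setT (fun x => w (r x)).
  by move=> mr; exact: measurableT_comp.
rewrite le_eqVlt; apply/orP; left; apply/eqP; apply: L2norm_ae.
- apply: measurable_funB; last exact: (mLfun _ id).
  apply: (mLfun _ (s1 \o (s \o s2))).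
  by do 2?apply: measurableT_comp.
- apply: measurable_funB; last exact: mLfun.
  exact: (mLfun _ (s \o s2) (measurableT_comp ms ms2)).
- by apply: filterS2 (mpb_ae Pss2 (u1 t tT)) (v2 t tT) => x /= -> ->.
Qed.

Lemma solution_map_continuous (T : R) (f D : R -> R -> R) (Lf LD : R)
  (F : ivp_data_quot mu -> L2path_quot mu T) :
  (forall u v t, `|f u t - f v t| <= Lf * `|u - v|) ->
  measurable_fun setT (fun z : R * R => D z.1 z.2) ->
  (forall u v, `|D u v| <= 1) ->
  (forall u v u' v',
    `|D u v - D u' v'| <= LD * (`|u - u'| + `|v - v'|)) ->
  is_solution_map f D F ->
  continuous_dist (@ivp_data_dist _ _ _ mu) (@L2path_dist _ _ _ mu T) F.
Proof.
move=> f_lip mD D1 D_lip F_sol x e e0.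
have Lf0 := reaction_lipschitz_ge0 f_lip.
have LD0 := lipschitz_const_ge0 D_lip.
have [u su Fu] := F_sol (repr x); rewrite reprK in Fu.
pose C := expR ((Lf + 2 * LD + 1) * T).
have C0 : 0 < C by exact: expR_gt0.
(* Initial error and coupling term are each below delta, so the Gronwall bound
   is at most (delta + delta) * C = e / 2. *)
pose delta := e / (4 * C).
have delta0 : 0 < delta by rewrite divr_gt0// mulr_gt0.
have [rho rho0 small] := coupling_uniformly_small mD D1 D_lip u delta0.
exists (Num.min rho delta); first by rewrite lt_min rho0.
move=> y; have [v sv Fv] := F_sol (repr y); rewrite reprK in Fv.
rewrite /ivp_data_dist; case: (repr x) su => U g su; case: (repr y) sv => V h sv.
move=> /ereal_inf_lt[_ [s Ps <-]] UVgh.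
have N0 := norm_infty1_ge0 (fun z => reindex2 s U z - V z).
have G0 : (0 <= L2dist mu (g \o s) h)%E by exact: Lnorm_ge0.
have UV_rho : (norm_infty1 mu (fun z => reindex2 s U z - V z)%R < rho%:E)%E.
  apply: le_lt_trans (lt_le_trans UVgh _); first by rewrite leeDl.
  by rewrite lee_fin ge_min lexx.
have gh_delta : (L2dist mu (g \o s) h < delta%:E)%E.
  apply: le_lt_trans (lt_le_trans UVgh _); first by rewrite leeDr.
  by rewrite lee_fin ge_min lexx orbT.
have [_ ms _ _] := Ps.
have mss : measurable_fun setT (fun z : I * I => (s z.1, s z.2)).
  by apply: measurable_fun_pair; exact: measurableT_comp.
have mU : measurable_fun setT (reindex2 s U) by exact: measurableT_comp.
have U01 z : 0 <= U z <= 1 := unit_kernel_bound U z.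
have V01 z : 0 <= V z <= 1 := unit_kernel_bound V z.
have U1 z : `|U z| <= 1 by have := U01 z; rewrite ler_norml; lra.
have V1 z : `|V z| <= 1 by have := V01 z; rewrite ler_norml; lra.
have UV1 z : `|reindex2 s U z - V z| <= 1.
  by have := U01 (s z.1, s z.2); have := V01 z; rewrite ler_norml /reindex2; lra.
have [u0 _] := su; have [v0 _] := sv.
have := solves_ivp_L2_solution su => /=.
move=> /(L2_solution_reindex f_lip mD D1 Ps) => /(_ _ U1) us.
have vs := solves_ivp_L2_solution sv.
have uv := L2_solution_stability f_lip mD D1 D_lip mU _ (fun z => U1 _) V1 UV1 (us _) vs
  (ltW delta0) _.
rewrite Fu Fv; apply: (@le_lt_trans _ _ (e / 2)%:E); last first.
  by rewrite lte_fin; lra.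
apply: (L2path_dist_le Ps) => t tT.
apply: le_trans (uv _ _ _ t tT) _ => //.
  move=> r rT; apply: small => //.
  by apply: measurable_funB.
rewrite lee_fin.
have uv0 : L2dist mu (u 0 \o s) (v 0) = L2dist mu (g \o s) h.
  apply: L2norm_ae.
  - apply: measurable_funB => //; exact: (measurableT_comp _ ms).
  - apply: measurable_funB => //; exact: (measurableT_comp _ ms).
  - by apply: filterS2 (mpb_ae Ps u0) v0 => z /= -> ->.
have init : fine (L2dist mu (u 0 \o s) (v 0)) <= delta.
  rewrite uv0 -lee_fin fineK ?ltW//.
  by rewrite ge0_fin_numE// (lt_trans gh_delta)// ltry.
apply: (@le_trans _ _ ((delta + delta) * C)).
  apply: ler_pM => //.
  - by rewrite addr_ge0 ?fine_ge0 ?Lnorm_ge0// ltW.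
  - by rewrite lerD2r.
  - rewrite /C ler_expR ler_wpM2l//; last by lra.
    by rewrite !addr_ge0// mulr_ge0.
have : delta * (4 * C) = e by rewrite divfK// gt_eqF// mulr_gt0.
by lra.
Qed.

End continuity.

Unset Implicit Arguments.
Set Strict Implicit.

Theorem lemma4p2 (R : realType) (T : R) (f D : R -> R -> R) (Lf LD s : R)
  (T_gt0 : 0 < T)
  (f_bounded : forall u t, `|f u t| <= 1)
  (f_lipschitz : forall u v t, `|f u t - f v t| <= Lf * `|u - v|)
  (f_continuous : forall u, continuous (f u))
  (D_bounded : forall u v, `|D u v| <= 1)
  (D_lipschitz : forall u v u' v',
    `|D u v - D u' v'| <= LD * (`|u - u'| + `|v - v'|))
  (s_gt1 : 1 < s)
  (D_sobolev : Hs_loc s (fun z : R * R => D z.1 z.2))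
  (F : ivp_data_quot (@unit_interval_lebesgue R) ->
       L2path_quot (@unit_interval_lebesgue R) T)
  (F_solution : is_solution_map f D F) :
  continuous_dist (@ivp_data_dist _ _ _ (@unit_interval_lebesgue R))
    (@L2path_dist _ _ _ (@unit_interval_lebesgue R) T) F.
Proof.
(* Among the weak derivatives of D is D itself, which is thus measurable. *)
have mD : measurable_fun setT (fun z : R * R => D z.1 z.2).
  have [G [G0 /(_ 0 0 (leq0n _))[[mG _] _] _]] := D_sobolev.
  by rewrite -G0.
exact: (solution_map_continuous f_lipschitz mD D_bounded D_lipschitz).
Qed.
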